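(* For all integers $d\geqslant 2$ and all real exponents $p\in[1,+\infty)$, the map $\Phi_{d\#}:\mathscr{P}(\mathbb{S}^1)\to\mathscr{P}(\mathbb{S}^1)$ satisfies $$\mathrm{mdim}_M(\Phi_{d\#},\mathrm{W}_p)\geqslant p(d-1).$$
   Context: $\mathbb{S}^1=\mathbb{R}/\mathbb{Z}$ with its usual quotient distance $|x-y|$, and $\Phi_d:\mathbb{S}^1\to\mathbb{S}^1$ is $\Phi_d(x)=dx \bmod 1$. $\mathscr{P}(\mathbb{S}^1)$ is the set of Borel probability measures on $\mathbb{S}^1$, and $\Phi_{d\#}$ is the push-forward map, $\Phi_{d\#}\mu(A)=\mu(\Phi_d^{-1}(A))$. The $L^p$ Wasserstein metric is $\mathrm{W}_p(\mu,\nu)=\left(\inf_\Pi\int_{\mathbb{S}^1\times\mathbb{S}^1}|x-y|^p\,\Pi(dx\,dy)\right)^{1/p}$, the infimum being over all probability measures $\Pi$ on $\mathbb{S}^1\times\mathbb{S}^1$ with first marginal $\mu$ and second marginal $\nu$; it makes $\mathscr{P}(\mathbb{S}^1)$ a compact metric space. Metric mean dimension: for a map $f:X\to X$ of a compact metric space $(X,\delta)$ and $n\in\mathbb{N}$, let $\delta_n(x,y)=\max\{\delta(f^k(x),f^k(y)):0\leqslant k\leqslant n\}$. For $\varepsilon>0$, a subset $S\subset X$ is $(n,\varepsilon)$-separated if $\delta_n(x,y)\geqslant\varepsilon$ whenever $x\neq y\in S$; $N(f,\varepsilon,n)$ is the maximal cardinality of an $(n,\varepsilon)$-separated set. Then $$\mathrm{mdim}_M(f,\delta)=\liminf_{\varepsilon\to0}\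 \limsup_{n\to+\infty}\frac{\log N(f,\varepsilon,n)}{n|\log\varepsilon|}.$$ *)

(* Defs.v *)
From HB Require Import structures.
From mathcomp Require Import all_boot all_order all_algebra.
From mathcomp Require Import generic_quotient ring_quotient.
From mathcomp Require Import ring.
From mathcomp Require Import all_classical all_reals all_analysis.

Set Implicit Arguments.
Unset Strict Implicit.
Unset Printing Implicit Defensive.

Import Order.TTheory GRing.Theory Num.Theory.
Import numFieldNormedType.Exports.

Local Open Scope classical_set_scope.
Local Open Scope ring_scope.
Local Open Scope quotient_scope.
Local Open Scope card_scope.

(* The additive group R / Z: Num.int_num_subdef is the predicate underlying the
   qualifier Num.int. *)
Definition circle (R : realType) : Type :=
  Quotient.quot (GRing.ZmodClosed.clone R (@Num.int_num_subdef R) _).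

HB.instance Definition _ (R : realType) := GRing.Zmodule.on (circle R).
HB.instance Definition _ (R : realType) := EqQuotient.on (circle R).
HB.instance Definition _ (R : realType) := isPointed.Build (circle R) 0.

Section Circle.
Context {R : realType}.
Implicit Types (x y z : circle R) (a b c : R).

Lemma circle_eqP a b :
  reflect (\pi_(circle R) a = \pi_(circle R) b) (a - b \is a Num.int).
Proof.
have -> : (a - b \is a Num.int) = (\pi_(circle R) a == \pi_(circle R) b).
  exact: Quotient.idealrBE.
exact: eqP.
Qed.

Definition circle_dist x y : R :=
  inf [set `|a - b| | a in [set a | \pi_(circle R) a = x]
                    & b in [set b | \pi_(circle R) b = y]].

Lemma circle_dist_le a b :
  circle_dist (\pi_(circle R) a) (\pi_(circle R) b) <= `|a - b|.
Proof.
apply: ge_inf; last by exists a => //; exists b.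
by exists 0 => _ [? _ [? _ <-]].
Qed.

Lemma circle_dist_lt x y e : circle_dist x y < e ->
  exists a b, [/\ \pi_(circle R) a = x, \pi_(circle R) b = y & `|a - b| < e].
Proof.
move=> /inf_lt[].
  exists `|repr x - repr y| => /=.
  by exists (repr x); [exact: reprK|exists (repr y) => //; exact: reprK].
by move=> _ [a ax [b yb <-]] abe; exists a, b.
Qed.

Lemma circle_dist_ge0 x y : 0 <= circle_dist x y.
Proof.
rewrite leNgt; apply/negP => /circle_dist_lt[a [b [_ _]]].
by rewrite ltNge normr_ge0.
Qed.

Lemma circle_distxx x : circle_dist x x = 0.
Proof.
apply/eqP; rewrite eq_le circle_dist_ge0 andbT.
by have := circle_dist_le (repr x) (repr x); rewrite reprK subrr normr0.
Qed.

Lemma circle_dist_sym x y : circle_dist x y = circle_dist y x.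
Proof.
congr inf; apply/seteqP.
by split=> _ [a ax [b yb <-]]; exists b => //; exists a => //; rewrite distrC.
Qed.

Lemma circle_dist_triangle y x z :
  circle_dist x z <= circle_dist x y + circle_dist y z.
Proof.
apply/ler_addgt0Pr => e e0.
have e20 : 0 < e / 2 by rewrite divr_gt0.
have := circle_dist_lt (ltr_pwDr e20 (lexx (circle_dist x y))).
have := circle_dist_lt (ltr_pwDr e20 (lexx (circle_dist y z))).
move=> [b [c [by_ <- bc]]] [a [b' [<- b'y ab]]].
have /circle_eqP bb' : \pi_(circle R) b' = \pi_(circle R) b by rewrite b'y.
have cE : \pi_(circle R) c = \pi_(circle R) (c + (b' - b)).
  by apply/circle_eqP; rewrite opprD addNKr rpredN.
rewrite [in leLHS]cE; apply: le_trans (circle_dist_le _ _) _.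
have -> : a - (c + (b' - b)) = (a - b') + (b - c).
  by ring.
apply: le_trans (ler_normD _ _) _.
by rewrite [e]splitr addrACA; apply: lerD; exact: ltW.
Qed.

Lemma circle_dist_eq0 x y : circle_dist x y = 0 -> x = y.
Proof.
move=> xy0.
have [|a [b [ax yb ab]]] := @circle_dist_lt x y 2^-1.
  by rewrite xy0 invr_gt0.
have [ab0|ab0] := eqVneq (a - b) 0.
  by rewrite -ax -yb; congr \pi; apply/eqP; rewrite -subr_eq0 ab0.
have [|a' [b' [a'x yb' ab']]] := @circle_dist_lt x y `|a - b|.
  by rewrite xy0 normr_gt0.
have /circle_eqP aa' : \pi_(circle R) a = \pi_(circle R) a' by rewrite ax a'x.
have /circle_eqP bb' : \pi_(circle R) b = \pi_(circle R) b' by rewrite yb yb'.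
have tt' : (a - b) - (a' - b') \is a Num.int.
  have -> : a - b - (a' - b') = (a - a') - (b - b') by ring.
  exact: rpredB.
have tt'1 : `|(a - b) - (a' - b')| < 1.
  rewrite (le_lt_trans (ler_normB _ _))// [ltRHS]splitr mul1r ltrD//.
  exact: lt_trans ab' ab.
have [/eqP|tt'0] := eqVneq ((a - b) - (a' - b')) 0.
  by rewrite subr_eq0 => /eqP tt'0; move: ab'; rewrite tt'0 ltxx.
by have := norm_intr_ge1 tt' tt'0; rewrite leNgt tt'1.
Qed.

HB.instance Definition _ := @isMetric.Build R (circle R) circle_dist
  circle_distxx circle_dist_eq0 circle_dist_sym circle_dist_triangle.

End Circle.

Section BorelCircle.
Context {R : realType}.

Let borel := <<s @open (circle R) >>.

Let borel0 : borel set0. Proof. exact: sigma_algebra0. Qed.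

Let borelC A : borel A -> borel (~` A).
Proof. by move=> mA; rewrite -setTD; exact: sigma_algebraCD. Qed.

Let borel_bigcup (F : (set (circle R))^nat) :
  (forall i, borel (F i)) -> borel (\bigcup_i F i).
Proof. exact: sigma_algebra_bigcup. Qed.

HB.instance Definition _ := @isMeasurable.Build (sigma_display (@open (circle R)))
  (circle R) borel borel0 borelC borel_bigcup.

End BorelCircle.

Section CircleMul.
Context {R : realType}.
Implicit Types (x : circle R) (a : R).

Definition circle_mul (d : nat) x : circle R := x *+ d.

Lemma circle_mul_pi d a :
  circle_mul d (\pi_(circle R) a) = \pi_(circle R) (a *+ d).
Proof.
rewrite /circle_mul; elim: d => [|d IHd]; first by rewrite !mulr0n -pi_zeror.
by rewrite !mulrS IHd -pi_addr.
Qed.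

Lemma continuous_circle_mul d : continuous (circle_mul d).
Proof.
move=> x; apply/(@cvg_ballP R (circle R) _ _ (nbhs_filter x)) => e e0.
apply/nbhs_ballP.
have d0 : 0 < d.+1%:R :> R by [].
exists (e / d.+1%:R) => /=; first exact: divr_gt0.
move=> y; rewrite !ballEmdist/= => /circle_dist_lt[a [b [<- <- ab]]].
rewrite !circle_mul_pi; apply: le_lt_trans (circle_dist_le _ _) _.
rewrite -mulrnBl normrMn; move: ab; rewrite ltr_pdivlMr// mulr_natr.
apply: le_lt_trans.
by rewrite -[leLHS]mulr_natr -[leRHS]mulr_natr ler_wpM2l ?ler_nat.
Qed.

Lemma measurable_circle_mul d : measurable_fun setT (circle_mul d).
Proof.
apply: (@measurability _ _ _ _ _ _ (@open (circle R))) => // _ [U oU <-].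
rewrite setTI; apply: sub_gen_smallest.
by move/continuousP : (@continuous_circle_mul d) => /(_ _ oU).
Qed.

HB.instance Definition _ d :=
  isMeasurableFun.Build _ _ _ _ (circle_mul d) (measurable_circle_mul d).

Definition circle_pushforward d (mu : probability (circle R) R) :
  probability (circle R) R := distribution mu (circle_mul d).

End CircleMul.

Section Wasserstein.
Context {R : realType}.
Implicit Types mu nu : probability (circle R) R.

Definition couplings mu nu : set (probability (circle R * circle R)%type R) :=
  [set Pi | forall A, measurable A ->
    Pi (A `*` setT) = mu A /\ Pi (setT `*` A) = nu A].

(* The infimum is finite (circle_dist is bounded and the product measure is a
   coupling), so that fine loses nothing. *)
Definition wasserstein (p : R) mu nu : R :=
  fine (ereal_inf [set \int[Pi]_z (circle_dist z.1 z.2 `^ p)%:E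
                  | Pi in couplings mu nu])%E `^ p^-1.

End Wasserstein.

Section MetricMeanDimension.
Context {R : realType} {X : Type}.
Variables (f : X -> X) (delta : X -> X -> R).

(* The maximum over 0 <= k <= n; the initial value is the term k = 0. *)
Definition bowen_dist (n : nat) (x y : X) : R :=
  \big[Num.max/delta x y]_(k < n.+1) delta (iter k f x) (iter k f y).

Definition bowen_separated (n : nat) (e : R) (S : set X) : Prop :=
  forall x y, S x -> S y -> x <> y -> e <= bowen_dist n x y.

(* The supremum of the cardinalities of the finite separated sets; it is +oo
   if they are unbounded. When X is a type of probability measures, distinct
   elements may agree on all measurable sets, since a measure is there a function
   on all sets; such elements are at distance 0, so no separated set with e > 0
   has both. *)
Definition sep_card (e : R) (n : nat) : \bar R :=
  ereal_sup [set k%:R%:E | k in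
    [set k : nat | exists2 S : set X, bowen_separated n e S & S #= `I_k]].

Definition metric_mean_dim : \bar R :=
  limf_einf (fun e : R =>
    limn_esup (fun n : nat => lne (sep_card e n) / (n%:R * `|ln e|)%:E)%E) 0^'+.

End MetricMeanDimension.

(* Main.v *)
(* Consider the laws mu_c of random points whose base-d digits are independent,
   the law of each digit being a probability vector taken from a grid of mesh
   1/Q, except that every (K+1)-st digit is forced to be 0. The map shifts the
   digits, so at each time k the law of the first digit of the image of mu_c is
   the k-th chosen vector. The forced zeros keep the supports of all these
   images inside the cylinders [i/d, (i+1)/d - d^-(K+1)], which are d^-(K+1)
   apart; two choices that differ at time k thus force a mass at least 1/Q to
   travel a distance bounded below by some r = r(d, K), and the images at time k
   are at W_p-distance at least r Q^(-1/p). This is at least eps for Q of order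
   eps^-p, which leaves about eps^(-p(d-1)) vectors for each free digit. Hence
   the dimension is at least p(d-1)K/(K+1), for all K. *)

Require Import Defs.
From mathcomp Require Import all_boot all_order all_algebra.
From mathcomp Require Import generic_quotient.
From mathcomp Require Import ring lra.
From mathcomp Require Import all_classical all_reals all_analysis.

Import Order.TTheory GRing.Theory Num.Theory.
Import numFieldNormedType.Exports.

Local Open Scope ring_scope.
Local Open Scope quotient_scope.

(* No measurability is assumed: for nonnegative functions the integral is a
   supremum over simple functions. *)
Lemma ge0_integral_mono d (T : measurableType d) (R : realType)
    (mu : {measure set T -> \bar R}) (f g : T -> \bar R) :
  (forall x, 0 <= f x)%E -> (forall x, f x <= g x)%E ->
  (\int[mu]_x f x <= \int[mu]_x g x)%E.
Proof.
move=> f0 fg.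
have g0 x : (0 <= g x)%E by exact: le_trans (fg x).
rewrite !ge0_integralTE//; apply: ereal_sup_le => _ [h hf <-].
by exists h => // x; exact: le_trans (hf x) (fg x).
Qed.

Lemma atomic_probability d (T : measurableType d) (R : realType)
    (W : finType) (P : W -> R) (X : W -> T) :
  (forall w, 0 <= P w) -> \sum_w P w = 1 ->
  exists mu : probability T R,
    forall A, mu A = (\sum_(w | X w \in A) P w)%:E.
Proof.
move=> P0 P1.
have [w0 _] : exists w0 : W, true.
  apply/existsP; apply: contraTT isT => /existsPn W0.
  move/eqP: P1; rewrite big_pred0 ?(eq_sym 0) ?oner_eq0// => w.
  by have := W0 w.
pose m k := mscale (NngNum (P0 (nth w0 (enum W) k)))
                   (dirac (X (nth w0 (enum W) k))).
pose mu : {measure set T -> \bar R} := msum m #|W|.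
have muE A : mu A = (\sum_(w | X w \in A) P w)%:E.
  transitivity (\sum_(w <- enum W) (P w)%:E * \d_(X w) A)%E.
    by rewrite /mu/= /msum cardE (big_nth w0) big_mkord.
  rewrite big_enum/= -sumEFin [RHS]big_mkcond/=; apply: eq_bigr => w _.
  by rewrite diracE; case: ifP => _; rewrite ?mule1 ?mule0.
have mu1 : mu setT = 1%E.
  by rewrite muE -P1; congr EFin; apply: eq_bigl => w; exact: mem_set.
(* The total mass is already 1, so normalizing leaves the values unchanged and only supplies the
   structure of a probability. *)
pose nu : probability T R := mnormalize mu \d_(X w0).
by exists nu => A; rewrite -muE /nu/= /mnormalize mu1 onee_eq0/= invr1 mule1.
Qed.

(** * Lower bounds on the Wasserstein distance *)

Section WassersteinLowerBound.
Context {R : realType}.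
Implicit Types mu nu : probability (circle R) R.
Local Open Scope classical_set_scope.

Lemma circle_dist_le1 (x y : circle R) : circle_dist x y <= 1.
Proof.
rewrite -(reprK x) -(reprK y); move: (repr x) (repr y) => a b.
have fracE (c : R) : \pi_(circle R) c = \pi_(circle R) (c - (Num.floor c)%:~R).
  by apply/circle_eqP; rewrite opprB addrC subrK intr_int.
rewrite (fracE a) (fracE b); apply: le_trans (circle_dist_le _ _) _.
have := floor_itv a; have := floor_itv b.
set fa := (_ (_ a))%:~R; set fb := (_ (_ b))%:~R.
rewrite ler_norml; lra.
Qed.

(** The strip over [A] is covered by [A * C] and by the strip over the complement of [C], whose
    masses add up to the right-hand side. *)
Lemma coupling_ge mu nu (Pi : probability (circle R * circle R)%type R) A C :
  couplings mu nu Pi -> measurable A -> measurable C ->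
  (mu A <= nu (~` C) + Pi (A `*` C))%E.
Proof.
move=> cPi mA mC.
have [<- _] := cPi _ mA; have [_ <-] := cPi _ (measurableC mC).
rewrite addeC; apply: le_trans (measureU2 _ _ _); last 2 first.
- exact: measurableX.
- by apply: measurableX => //; exact: measurableC.
apply: le_measure; rewrite ?inE; first exact: measurableX.
  by apply: measurableU; apply: measurableX => //; exact: measurableC.
move=> [x y] /= [Ax _].
by have [Cy|nCy] := pselect (C y); [left|right].
Qed.

(** Every coupling must carry a mass at least [t] from [A] to [C], at a cost of at least [r ^ p] per
    unit of mass. *)
Lemma wasserstein_lower_bound (p r t : R) mu nu A C :
  1 <= p -> 0 <= r -> 0 <= t -> measurable A -> measurable C ->
  (forall x y, A x -> C y -> r <= circle_dist x y) ->
  (nu (~` C) + t%:E <= mu A)%E ->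
  r * t `^ p^-1 <= wasserstein p mu nu.
Proof.
move=> p1 r0 t0 mA mC AC tAC.
have p0 : p != 0 by rewrite gt_eqF// (lt_le_trans ltr01).
have pge0 : 0 <= p by exact: le_trans p1.
rewrite /wasserstein; set I := ereal_inf _.
have lb : ((r `^ p * t)%:E <= I)%E.
  apply: le_ereal_inf_tmp => _ [Pi cPi <-].
  apply: (@le_trans _ _ (\int[Pi]_z ((cst (r `^ p)%:E) \_ (A `*` C)) z)%E).
    rewrite -integral_mkcond integral_cst/=; last exact: measurableX.
    rewrite EFinM lee_wpmul2l ?lee_fin ?powR_ge0//.
    have := coupling_ge _ _ _ _ _ cPi mA mC.
    move/(le_trans tAC); rewrite leeD2lE//.
    by rewrite fin_num_measure//; exact: measurableC.
  apply: ge0_integral_mono => -[x y]; rewrite patchE/=; case: ifPn => //.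
  - by rewrite lee_fin powR_ge0.
  - rewrite inE => -[/= Ax Cy].
    by rewrite lee_fin ge0_ler_powR ?nnegrE ?circle_dist_ge0//; exact: AC.
  - by rewrite lee_fin powR_ge0.
(* Finiteness matters because [fine] sends +oo to 0; the product coupling costs at most 1. *)
have ub : (I <= 1)%E.
  apply: (@le_trans _ _ (\int[mu \x nu]_z (circle_dist z.1 z.2 `^ p)%:E)%E).
    apply: ereal_inf_lbound; exists (mu \x nu)%E => // A' mA'.
    split; rewrite [LHS]product_measure1E//.
      by rewrite [X in (_ * X)%E]probability_setT mule1.
    by rewrite [X in (X * _)%E]probability_setT mul1e.
  rewrite -(probability_setT (mu \x nu)%E) -[leRHS]mul1e -integral_cst//.
  apply: ge0_integral_mono => z; rewrite lee_fin ?powR_ge0//.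
  have -> : 1 = 1 `^ p :> R by rewrite powR1.
  by rewrite ge0_ler_powR ?nnegrE ?circle_dist_ge0 ?circle_dist_le1.
have Ifin : I \is a fin_num.
  by rewrite fin_numElt (lt_le_trans (ltNyr _) lb) (le_lt_trans ub (ltry _)).
have {}lb : r `^ p * t <= fine I by rewrite -lee_fin fineK.
have -> : r * t `^ p^-1 = (r `^ p * t) `^ p^-1.
  by rewrite powRM ?powR_ge0// -powRrM divff// powRr1.
rewrite ge0_ler_powR ?nnegrE ?invr_ge0//.
  by rewrite mulr_ge0 ?powR_ge0.
by apply: le_trans lb; rewrite mulr_ge0 ?powR_ge0.
Qed.

End WassersteinLowerBound.

(** * Base-d expansions and cylinders on the circle *)

Section Digits.
Context {R : realType}.
Variable d : nat.
Hypothesis d_gt1 : (1 < d)%N.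

Let d0 : 0 < d%:R :> R. Proof. by rewrite ltr0n ltnW. Qed.

(** The base-d number 0.w_0 w_1 ... truncated after [N] digits, in Horner form so that multiplying
    by d releases the first digit. *)
Fixpoint radix (N : nat) (w : nat -> nat) : R :=
  if N is N'.+1 then ((w 0)%:R + radix N' (fun j => w j.+1)) / d%:R else 0.

Lemma radix_ge0 N w : 0 <= radix N w.
Proof.
by elim: N w => //= N IH w; rewrite divr_ge0 ?addr_ge0 ?ler0n.
Qed.

Lemma radix_le1 N w : (forall j, w j < d)%N -> radix N w <= 1.
Proof.
elim: N w => //= N IH w wd.
rewrite ler_pdivrMr// mul1r.
have := IH _ (fun j => wd j.+1); have := wd 0; rewrite -(ler_nat R) -natr1; lra.
Qed.

Lemma radix_le_gap N w K j : (forall i, w i < d)%N -> w j = 0 -> (j < K)%N ->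
  radix N w <= 1 - (d%:R ^+ K)^-1.
Proof.
move=> wd wj jK.
(* The bound by the exact position of the zero digit is the one that passes through the induction on
   [j]. *)
apply: (@le_trans _ _ (1 - (d%:R ^+ j.+1)^-1)); last first.
  rewrite lerD2l lerN2 lef_pV2 ?posrE ?exprn_gt0//.
  by rewrite ler_weXn2l// ler1n ltnW.
elim: j N w wd wj {K jK} => [|j IH] [|N] w wd wj /=.
- by rewrite expr1 subr_ge0 invf_le1// ler1n ltnW.
- rewrite wj add0r expr1 ler_pdivrMr// mulrBl mulVf ?gt_eqF// mul1r.
  have := radix_le1 N _ (fun i => wd i.+1).
  have : 2 <= d%:R :> R by rewrite ler_nat.
  lra.
- by rewrite subr_ge0 invf_le1 ?exprn_gt0// exprn_ege1// ler1n ltnW.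
- rewrite ler_pdivrMr// mulrBl exprSr invfM mulrVK ?unitfE ?gt_eqF// mul1r.
  have := IH N _ (fun i => wd i.+1) wj.
  have := wd 0; rewrite -(ler_nat R) -natr1; lra.
Qed.

Lemma circle_mul_radix N w :
  circle_mul d (\pi_(circle R) (radix N.+1 w)) =
  \pi_(circle R) (radix N (fun j => w j.+1)).
Proof.
rewrite circle_mul_pi; apply/circle_eqP => /=.
by rewrite -[_ *+ d]mulr_natr mulfVK ?gt_eqF// addrK natr_int.
Qed.

Lemma iter_circle_mul_radix k N w :
  iter k (circle_mul d) (\pi_(circle R) (radix (k + N) w)) =
  \pi_(circle R) (radix N (fun j => w (k + j)%N)).
Proof.
elim: k w => [//|k IH] w.
by rewrite iterSr addSn circle_mul_radix IH.
Qed.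

Lemma circle_dist_ge (s a b : R) : (forall k : int, s <= `|a - b + k%:~R|) ->
  s <= circle_dist (\pi_(circle R) a) (\pi_(circle R) b).
Proof.
move=> H; rewrite leNgt; apply/negP => /circle_dist_lt[a' [b' [aa bb]]].
have /circle_eqP := aa; have /circle_eqP := bb.
move=> /intrP[kb kbE] /intrP[ka kaE].
have := H (ka - kb); rewrite leNgt => /negP; congr (~ is_true (_ < _)).
by congr `|_|; rewrite rmorphB/= -kaE -kbE; ring.
Qed.

Variable K : nat.
Let delta : R := (d%:R ^+ K)^-1.

(** Midpoint of [i/d, (i + 1 - delta)/d], the i-th cylinder without its final gap. *)
Definition cylinder_center (i : nat) : circle R :=
  \pi_(circle R) ((i%:R + (1 - delta) / 2) / d%:R).

Lemma circle_dist_center_le i (x : R) : 0 <= x <= 1 - delta ->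
  circle_dist (cylinder_center i) (\pi_(circle R) ((i%:R + x) / d%:R)) <=
  (1 - delta) / (2 * d%:R).
Proof.
move=> x01; apply: le_trans (circle_dist_le _ _) _.
rewrite -mulrBl normrM [`|_^-1|]gtr0_norm ?invr_gt0// invfM mulrA.
by rewrite ler_wpM2r ?invr_ge0 ?ler0n// ler_norml; move: x01; lra.
Qed.

(** After scaling by d, every lift of the difference is a nonzero integer, as i and j differ modulo
    d, plus an offset of size at most (1 - delta)/2. *)
Lemma circle_dist_center_ge i j (x : R) : 0 <= x <= 1 - delta ->
  (i < d)%N -> (j < d)%N -> i != j ->
  (1 + delta) / (2 * d%:R) <=
  circle_dist (cylinder_center i) (\pi_(circle R) ((j%:R + x) / d%:R)).
Proof.
move=> x01 id jd ij; apply: circle_dist_ge => k.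
have -> : (i%:R + (1 - delta) / 2) / d%:R - (j%:R + x) / d%:R + k%:~R =
   ((i%:Z - j%:Z + k * d%:Z)%:~R + ((1 - delta) / 2 - x)) / d%:R.
  by rewrite !rmorphD rmorphN rmorphM/= !pmulrn; field; rewrite gt_eqF.
rewrite normrM [`|_^-1|]gtr0_norm ?invr_gt0// invfM mulrA.
rewrite ler_wpM2r ?invr_ge0 ?ler0n//.
have n0 : i%:Z - j%:Z + k * d%:Z != 0.
  apply: contra ij => /eqP ijk.
  rewrite -(modn_small id) -(modn_small jd).
  rewrite -eqz_nat -!modz_nat eqz_mod_dvd; apply/dvdzP; exists (- k).
  by rewrite mulNr; apply/eqP; rewrite -addr_eq0 ijk.
have : 1 <= `|(i%:Z - j%:Z + k * d%:Z)%:~R : R|.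
  by rewrite norm_intr_ge1 ?intr_int ?intr_eq0.
have xd : `|(1 - delta) / 2 - x| <= (1 - delta) / 2.
  by rewrite ler_norml; move: x01; lra.
have := lerB_normD (i%:Z - j%:Z + k * d%:Z)%:~R ((1 - delta) / 2 - x).
move: xd; lra.
Qed.

End Digits.

(** * Product laws on words, with digit laws on a grid *)

Section ProductWeights.
Context {R : realType} {U D : finType}.
Variable a : U -> D -> R.
Hypothesis a1 : forall u, \sum_i a u i = 1.

Definition word_weight (w : {ffun U -> D}) : R := \prod_u a u (w u).

Lemma sum_word_weight : \sum_w word_weight w = 1.
Proof. by rewrite -bigA_distr_bigA big1. Qed.

Lemma sum_word_weight_marginal (u0 : U) (i : D) :
  \sum_(w : {ffun U -> D} | w u0 == i) word_weight w = a u0 i.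
Proof.
(* Putting the indicator of [w u0 == i] into the factor at [u0] keeps each summand a product, so the
   sum over words factorizes. *)
pose b u j := if u == u0 then a u j * (j == i)%:R else a u j.
rewrite big_mkcond/=.
transitivity (\sum_(w : {ffun U -> D}) \prod_u b u (w u)).
  apply: eq_bigr => w _; rewrite /word_weight /b.
  rewrite (bigD1 u0)//= [in RHS](bigD1 u0)//= eqxx.
  rewrite [in RHS](eq_bigr (fun u => a u (w u))); last first.
    by move=> u /negbTE ->.
  by case: eqP => _; rewrite ?mulr1// mulr0 mul0r.
rewrite -bigA_distr_bigA (bigD1 u0)//= [X in _ * X]big1 ?mulr1.
  rewrite /b eqxx (bigD1 i)//= eqxx mulr1 big1 ?addr0// => j /negbTE ->.
  by rewrite mulr0.
by move=> u /negbTE uu0; rewrite /b uu0 a1.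
Qed.

End ProductWeights.

Section GridWeights.
Context {R : realType}.
Variables e q : nat.
Hypotheses (e0 : (0 < e)%N) (q0 : (0 < q)%N).

(** Each of the e nonzero digits gets a multiple of 1/(eq) below 1/e, freely chosen; digit 0 takes
    the remainder. This gives q^e vectors. *)
Definition grid_weight (v : {ffun 'I_e -> 'I_q}) (i : 'I_e.+1) : R :=
  if unlift ord0 i is Some t then (v t)%:R / (e * q)%:R
  else 1 - \sum_t (v t)%:R / (e * q)%:R.

Lemma grid_weight_lift v t :
  grid_weight v (lift ord0 t) = (v t)%:R / (e * q)%:R.
Proof. by rewrite /grid_weight liftK. Qed.

Lemma grid_weight_ge0 v i : 0 <= grid_weight v i.
Proof.
rewrite /grid_weight; case: unliftP => [t _|_]; first by rewrite divr_ge0.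
rewrite subr_ge0 -mulr_suml ler_pdivrMr ?ltr0n ?muln_gt0 ?e0//.
rewrite mul1r -natr_sum ler_nat.
apply: (@leq_trans (\sum_(t < e) q)).
  by apply: leq_sum => t _; exact: ltnW.
by rewrite sum_nat_const card_ord.
Qed.

Lemma sum_grid_weight v : \sum_i grid_weight v i = 1.
Proof.
rewrite big_ord_recl; under eq_bigr do rewrite grid_weight_lift.
by rewrite /grid_weight unlift_none subrK.
Qed.

Lemma grid_weight_lt (v v' : {ffun 'I_e -> 'I_q}) t : (v' t < v t)%N ->
  grid_weight v' (lift ord0 t) + ((e * q)%:R)^-1 <= grid_weight v (lift ord0 t).
Proof.
move=> lt; rewrite !grid_weight_lift -[X in _ + X]mul1r -mulrDl.
by rewrite ler_wpM2r// natr1 ler_nat.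
Qed.

End GridWeights.

(** * Words with a forced zero at the end of each block *)

Section Words.
Variables e m K : nat.

Definition word := {ffun 'I_m * 'I_K -> 'I_e.+1}.

(* Position j = l (K+1) + t carries the digit w (l, t) when t < K, and the
   forced digit 0 when t = K or l >= m. *)
Definition letter (w : word) (j : nat) : nat :=
  if insub (j %/ K.+1)%N is Some l then
    if insub (j %% K.+1)%N is Some t then w (l, t) else 0
  else 0.

Definition position (u : 'I_m * 'I_K) : nat := u.1 * K.+1 + u.2.

Lemma letter_lt w j : (letter w j < e.+1)%N.
Proof. by rewrite /letter; case: insub => // l; case: insub. Qed.

Lemma letter_position w u : letter w (position u) = w u.
Proof.
case: u => l t; rewrite /letter /position/=.
have tK : (t < K.+1)%N by rewrite (ltn_trans (ltn_ord t)).
rewrite divnMDl// divn_small// addn0 modnMDl modn_small//.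
by rewrite !valK.
Qed.

(** The index is l(K+1) + K, the end of the block of [u], written as an offset in the tail that
    follows position [u]. *)
Lemma letter_gap w u : letter w ((position u).+1 + (K - u.2.+1)) = 0.
Proof.
case: u => l t; rewrite /letter /position/=.
rewrite -addnS -addnA subnKC//.
rewrite divnMDl// divn_small// addn0 modnMDl modn_small// valK.
by rewrite insubF// ltnn.
Qed.

Lemma position_lt u : (position u < m * K.+1)%N.
Proof.
case: u => l t; rewrite /position/=.
apply: (@leq_trans (l.+1 * K.+1)); last by rewrite leq_mul2r ltn_ord orbT.
by rewrite mulSn addnC ltn_add2r (ltn_trans (ltn_ord t)).
Qed.

End Words.

Local Open Scope classical_set_scope.
Local Open Scope card_scope.

(** * Separation of the iterated measures *)

Lemma iter_pushforward (R : realType) (d k : nat)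
    (mu : probability (circle R) R) A :
  iter k (circle_pushforward d) mu A = mu (iter k (circle_mul d) @^-1` A).
Proof.
elim: k A => [//|k IH] A.
rewrite iterS -[LHS]/(iter k (circle_pushforward d) mu (circle_mul d @^-1` A)).
by rewrite IH.
Qed.

Section Separation.
Context {R : realType}.
Variables e m K q : nat.
Hypotheses (e0 : (0 < e)%N) (q0 : (0 < q)%N).

Local Notation d := e.+1.
Local Notation delta := ((d%:R ^+ K)^-1 : R).

(** A choice of one grid vector, the law of the digit, for each free position. *)
Definition code := {ffun 'I_m * 'I_K -> {ffun 'I_e -> 'I_q}}.

Definition code_weight (c : code) (w : word e m K) : R :=
  word_weight (fun u => grid_weight e q (c u)) w.

Definition word_point (w : word e m K) : circle R :=
  \pi_(circle R) (radix d (m * K.+1) (letter e m K w)).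

Let d_gt1 : (1 < d)%N. Proof. by []. Qed.

Lemma code_weight_ge0 c w : 0 <= code_weight c w.
Proof. by apply: prodr_ge0 => u _; exact: grid_weight_ge0. Qed.

(* The forced 0 that ends the block of position u keeps the tail x away from
   1. *)
Lemma iter_word_point w u : exists2 x : R, 0 <= x <= 1 - delta &
  iter (position m K u) (circle_mul d) (word_point w) =
  \pi_(circle R) (((w u)%:R + x) / d%:R).
Proof.
pose N := (m * K.+1 - (position m K u).+1)%N.
have NE : (m * K.+1 = position m K u + N.+1)%N.
  by rewrite addnS -addSn subnKC// position_lt.
rewrite /word_point NE iter_circle_mul_radix//=.
rewrite addn0 letter_position.
eexists; last by [].
rewrite radix_ge0//=; apply: (@radix_le_gap _ _ _ _ _ _ (K - u.2.+1)) => //.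
- by move=> i; exact: letter_lt.
- by rewrite addnS -addSn letter_gap.
- by rewrite -subSn// subSS leq_subr.
Qed.

(* The i-th cylinder, without its gap, is a ball of radius (1 - delta) / (2 d)
   and the other cylinders are at distance at least (1 + delta) / (2 d) from its
   center: the radii below for s = -1 and s = 1 lie in between. *)
Definition near_cylinder (s : R) (i : nat) : set (circle R) :=
  [set y | circle_dist (cylinder_center d K i) y <
           2^-1 / d%:R + s * delta / (4 * d%:R)].

Lemma measurable_near_cylinder s i : measurable (near_cylinder s i).
Proof.
apply: sub_gen_smallest.
rewrite openE /near_cylinder => x /=; rewrite -subr_gt0; set r := _ - _ => r0.
apply/nbhs_ballP; exists r => //= y; rewrite ballEmdist/= => xy.
apply: le_lt_trans (circle_dist_triangle x _ _) _.
by rewrite -ltrBrDl.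
Qed.

Let delta_gt0 : 0 < delta. Proof. by rewrite invr_gt0 exprn_gt0. Qed.

Let d_neq0 : (1 + e%:R != 0 :> R) && (d%:R ^+ K != 0 :> R).
Proof. by rewrite nat1r expf_neq0 pnatr_eq0. Qed.

Lemma near_cylinder_inner (w : word e m K) u :
  near_cylinder (-1) (w u)
    (iter (position m K u) (circle_mul d) (word_point w)).
Proof.
have [x x01 ->] := iter_word_point w u.
apply: le_lt_trans (circle_dist_center_le _ d_gt1 _ _ _ x01) _.
rewrite -subr_gt0 [ltRHS](_ : _ = delta / (4 * d%:R)).
  by rewrite divr_gt0.
by field; rewrite d_neq0.
Qed.

Lemma near_cylinder_outer (w : word e m K) u (i : 'I_d) : w u != i ->
  ~ near_cylinder 1 i (iter (position m K u) (circle_mul d) (word_point w)).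
Proof.
have [x x01 ->] := iter_word_point w u => wi.
apply/negP; rewrite -leNgt eq_sym in wi *.
apply: le_trans (circle_dist_center_ge _ d_gt1 _ _ _ _ x01 _ _ _) => //.
rewrite -subr_ge0 [leRHS](_ : _ = delta / (4 * d%:R)).
  by rewrite ltW// divr_gt0.
by field; rewrite d_neq0.
Qed.

(** The bound is the difference of the radii for s = 1 and s = -1. *)
Lemma near_cylinder_gap i x y :
  near_cylinder (-1) i x -> ~ near_cylinder 1 i y ->
  delta / (2 * d%:R) <= circle_dist x y.
Proof.
rewrite /near_cylinder/= => ix /negP; rewrite -leNgt => iy.
have := circle_dist_triangle x (cylinder_center d K i) y.
move: ix iy; set s := _ * delta / _; set s' := _ * delta / _.
have -> : delta / (2 * d%:R) = s' - s.
  by rewrite /s /s'; field; rewrite d_neq0.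
set b := 2^-1 / _; clearbody s s' b; lra.
Qed.

Lemma code_measures : exists mu : code -> probability (circle R) R,
  forall c A, mu c A = (\sum_(w | word_point w \in A) code_weight c w)%:E.
Proof.
have /boolp.choice[mu muE] : forall c : code,
    exists nu : probability (circle R) R,
      forall A, nu A = (\sum_(w | word_point w \in A) code_weight c w)%:E.
  move=> c; apply: atomic_probability; first exact: code_weight_ge0.
  by apply: sum_word_weight => u; exact: sum_grid_weight.
by exists mu.
Qed.

Variable mu : code -> probability (circle R) R.
Hypothesis muE :
  forall c A, mu c A = (\sum_(w | word_point w \in A) code_weight c w)%:E.

Local Notation mu_ c u :=
  (iter (position m K u) (circle_pushforward d) (mu c)).

(** At time [position u], words with digit i at [u] lie in the inner ball, and those with another
    digit outside the outer one. The two resulting inequalities place the digit weight between the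
    two masses. *)
Lemma code_measure_inner (c : code) u (i : 'I_d) :
  ((grid_weight e q (c u) i)%:E <= mu_ c u (near_cylinder (-1) i))%E.
Proof.
rewrite iter_pushforward muE lee_fin.
rewrite -(sum_word_weight_marginal (fun u => grid_weight e q (c u))); last first.
  by move=> u'; exact: sum_grid_weight.
rewrite big_mkcond [leRHS]big_mkcond; apply: ler_sum => w _ /=.
case: eqP => [<-|_]; last by case: ifP => // _; exact: code_weight_ge0.
by rewrite mem_set//; exact: near_cylinder_inner.
Qed.

Lemma code_measure_outer (c : code) u (i : 'I_d) :
  (mu_ c u (near_cylinder 1 i) <= (grid_weight e q (c u) i)%:E)%E.
Proof.
rewrite iter_pushforward muE lee_fin.
rewrite -(sum_word_weight_marginal (fun u => grid_weight e q (c u))); last first.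
  by move=> u'; exact: sum_grid_weight.
rewrite big_mkcond [leRHS]big_mkcond; apply: ler_sum => w _ /=.
case: eqP => [_|/eqP wi]; first by case: ifP => // _; exact: code_weight_ge0.
by rewrite memNset//; exact: near_cylinder_outer.
Qed.

Lemma code_measure_gap (c c' : code) u t : (c' u t < c u t)%N ->
  (mu_ c' u (near_cylinder 1 (lift ord0 t : 'I_d)) + ((e * q)%:R^-1)%:E <=
   mu_ c u (near_cylinder (-1) (lift ord0 t : 'I_d)))%E.
Proof.
move=> /(grid_weight_lt (R := R)) cc.
apply: le_trans (code_measure_inner c u _).
apply: le_trans (leeD2r _ (code_measure_outer c' u _)) _.
by rewrite -EFinD lee_fin.
Qed.

Lemma wasserstein_code (p : R) (c c' : code) u : 1 <= p -> c u != c' u ->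
  delta / (2 * d%:R) * ((e * q)%:R^-1) `^ p^-1 <=
    wasserstein p (mu_ c u) (mu_ c' u).
Proof.
move=> p1 /eqP/ffunP/existsNP[t /eqP].
have r0 : 0 <= delta / (2 * d%:R) by rewrite ltW// divr_gt0.
set i : 'I_d := lift ord0 t.
have mB := measurable_near_cylinder (-1) i.
have mF := measurable_near_cylinder 1 i.
rewrite -val_eqE neq_ltn => /orP[cc|cc].
(* Here [c'] gives digit i more weight than [c], so mass must enter the ball: it travels from
   outside the outer ball to the inner one. *)
- apply: (@wasserstein_lower_bound _ _ _ _ _ _ (~` near_cylinder 1 i)
    (near_cylinder (-1) i)) => //.
  + exact: measurableC.
  + move=> x y nx ny; rewrite circle_dist_sym.
    exact: near_cylinder_gap ny nx.
  + rewrite !probability_setC//.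
    have := code_measure_gap _ _ _ _ cc; rewrite -/i.
    rewrite -(fineK (fin_num_measure (mu_ c u) _ mF)).
    rewrite -(fineK (fin_num_measure (mu_ c' u) _ mB)).
    rewrite -!EFinN -!EFinD !lee_fin; lra.
- apply: (@wasserstein_lower_bound _ _ _ _ _ _ (near_cylinder (-1) i)
    (~` near_cylinder 1 i)) => //.
  + exact: measurableC.
  + by move=> x y; exact: near_cylinder_gap.
  + by rewrite setCK; exact: code_measure_gap.
Qed.

(** If two codes had the same measure, a digit weighted differently would give the inner ball more
    mass than the outer ball containing it. *)
Lemma code_measure_inj : injective mu.
Proof.
move=> c c' cc'; apply/eqP; apply: contraT => /eqP/ffunP/existsNP[u /eqP].
move=> /eqP/ffunP/existsNP[t /eqP].
wlog cc : c c' cc' / (c' u t < c u t)%N => [H cct|].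
  move: (cct); rewrite -val_eqE neq_ltn => /orP[lt|lt].
    by apply: (H c' c) => //; rewrite eq_sym.
  exact: (H c c').
have := code_measure_gap _ _ _ _ cc; rewrite cc' => gap _.
have mB := measurable_near_cylinder (-1) (lift ord0 t : 'I_d).
have mF := measurable_near_cylinder 1 (lift ord0 t : 'I_d).
have : (mu_ c' u (near_cylinder (-1) (lift ord0 t : 'I_d)) <=
        mu_ c' u (near_cylinder 1 (lift ord0 t : 'I_d)))%E.
  apply: le_measure; rewrite ?inE// => x /= /lt_le_trans; apply.
  by rewrite lerD2l ler_wpM2r ?invr_ge0// ler_wpM2r ?ltW//; lra.
move/(le_trans gap); rewrite leNgt lteDl ?fin_num_measure//.
by rewrite lte_fin invr_gt0 ltr0n muln_gt0 e0 q0.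
Qed.

End Separation.

(** * Counting separated sets and passing to the limit *)

Lemma bowen_dist_ge (R : realType) (X : Type) (f : X -> X) (delta : X -> X -> R)
    (n k : nat) x y : (k <= n)%N ->
  delta (iter k f x) (iter k f y) <= bowen_dist f delta n x y.
Proof.
by rewrite -ltnS => kn; apply: (@le_bigmax _ _ _ _ _ (Ordinal kn)).
Qed.

Lemma sep_card_ge (R : realType) (X : Type) (f : X -> X) (delta : X -> X -> R)
    (eps : R) (n : nat) (I : finType) (g : I -> X) : injective g ->
  (forall i j, i != j -> eps <= bowen_dist f delta n (g i) (g j)) ->
  (#|I|%:R%:E <= sep_card f delta eps n)%E.
Proof.
move=> ginj gsep; apply: ereal_sup_ubound; exists #|I| => //=.
exists (range g).
  move=> _ _ [i _ <-] [j _ <-] gij; apply: gsep.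
  by apply: contra_notN gij => /eqP ->.
apply: (card_eq_trans (inj_card_eq (in2W ginj))).
apply: (card_eq_trans _ (card_esym card_II)).
rewrite -[X in X #= _](_ : range (@enum_val I predT) = _).
  by apply: inj_card_eq; apply: in2W; exact: enum_val_inj.
by apply/seteqP; split => // i _; exists (enum_rank i); rewrite ?enum_rankK.
Qed.

(** A bound along a subsequence is enough, so times can be restricted to whole numbers of blocks. *)
Lemma limn_esup_ge (R : realType) (u : nat -> \bar R) (x : \bar R) :
  (forall N, exists2 n, (N <= n)%N & (x <= u n)%E) -> (x <= limn_esup u)%E.
Proof.
move=> xu; apply: le_ereal_inf_tmp => _ [V [N _ NV] <-].
have [n Nn xun] := xu N.
by apply: le_ereal_sup_tmp; exists (u n) => //; exists n => //; exact: NV.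
Qed.

Lemma limf_einf_ge (R : realType) (F : set (set R)) (f : R -> \bar R)
    (x : \bar R) : F [set t | x <= f t]%E -> (x <= limf_einf f F)%E.
Proof.
move=> Fx; rewrite limf_einfE; apply: le_ereal_sup_tmp.
exists (ereal_inf (f @` [set t | x <= f t]%E)).
  by exists [set t | x <= f t]%E.
by apply: le_ereal_inf_tmp => _ [t /= xt <-].
Qed.

Lemma sep_card_pushforward (R : realType) (p eps : R) (e m K q : nat) :
  1 <= p -> (0 < e)%N -> (0 < q)%N ->
  eps <= (e.+1%:R ^+ K)^-1 / (2 * e.+1%:R) * ((e * q)%:R^-1) `^ p^-1 ->
  (((q ^ e) ^ (m * K))%:R%:E <=
   sep_card (@circle_pushforward R e.+1) (wasserstein p) eps (m * K.+1))%E.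
Proof.
move=> p1 e0 q0 epsle.
have [mu muE] := @code_measures R e m K q e0 q0.
have -> : ((q ^ e) ^ (m * K) = #|{: code e m K q}|)%N.
  by rewrite card_ffun card_prod !card_ord card_ffun !card_ord.
apply: (@sep_card_ge _ _ _ _ _ _ _ mu).
  exact: (code_measure_inj _ _ _ _ _ _ _ muE).
move=> c c' /eqP/ffunP/existsNP[u /eqP cu].
apply: le_trans (bowen_dist_ge _ _ _ _ _ (position m K u) _ _ _); last first.
  exact/ltnW/position_lt.
apply: le_trans epsle _.
exact: (wasserstein_code _ _ _ _ _ _ _ muE).
Qed.

(** Taking q as the integer part of (r/eps)^p / e gives ln q >= p |ln eps| - C, and the strict
    inequality [x < kappa * p] absorbs the constant for small eps. *)
Lemma grid_size (R : realType) (p r x kappa : R) (e : nat) :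
  1 <= p -> 0 < r -> (0 < e)%N -> 0 <= kappa -> x < kappa * p ->
  \forall eps \near 0^'+, exists q : nat,
    [/\ (0 < q)%N, eps <= r * ((e * q)%:R^-1) `^ p^-1 &
        x * `|ln eps| <= kappa * ln q%:R].
Proof.
move=> p1 r0 e0 k0 xkp.
have p0 : 0 < p by exact: lt_le_trans p1.
have eR0 : 0 < e%:R :> R by rewrite ltr0n.
(* With l = - ln eps, [M1 <= l] ensures y >= 1, hence q > 0, and [M2 <= l] is x l <= kappa (p l -
   C). The ln 2 in [C] pays for truncating y. *)
pose M1 := ln (e%:R : R) / p - ln r.
pose C := ln (e%:R : R) + ln 2 - p * ln r.
pose M2 := kappa * C / (kappa * p - x).
have : 0 < expR (- (1 + `|M1| + `|M2|)) by exact: expR_gt0.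
move=> /nbhs_right_lt small.
near=> eps.
have eps0 : 0 < eps by near: eps; exact: nbhs_right_gt.
have L : 1 + `|M1| + `|M2| <= - ln eps.
  by rewrite lerNr ltW// -ltr_expR lnK.
set l := - ln eps in L.
have M1l : M1 <= l.
  by have := ler_norm M1; have := normr_ge0 M2; lra.
have M2l : M2 <= l.
  by have := ler_norm M2; have := normr_ge0 M1; lra.
have l0 : 0 < l by have := normr_ge0 M1; have := normr_ge0 M2; lra.
pose y := (r / eps) `^ p / e%:R.
have y0 : 0 < y by rewrite divr_gt0// powR_gt0// divr_gt0.
have lny : ln y = p * (ln r + l) - ln (e%:R : R).
  by rewrite ln_div ?posrE// ?powR_gt0 ?divr_gt0// ln_powR ln_div.
have y1 : 1 <= y.
  rewrite -ler_ln ?posrE// ln1 lny subr_ge0 mulrC -ler_pdivrMr//.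
  by move: M1l; rewrite /M1; lra.
exists (Num.truncn y); set q := Num.truncn y.
have q0 : (0 < q)%N by rewrite truncn_gt0.
have [qy yq] := andP (truncn_itv (ltW y0)).
have qR0 : 0 < q%:R :> R by rewrite ltr0n.
split => //.
- rewrite mulrC -ler_pdivrMr//.
  have -> : eps / r = ((eps / r) `^ p) `^ p^-1.
    by rewrite -powRrM divff ?gt_eqF// powRr1// ltW// divr_gt0.
  have p'0 : 0 <= p^-1 by rewrite invr_ge0 ltW.
  rewrite ge0_ler_powR ?nnegrE ?powR_ge0 ?invr_ge0 ?ler0n ?(ltW p0)//.
  have re0 : 0 < r / eps by rewrite divr_gt0.
  rewrite -[eps / r]invf_div -(powR_inv1 (ltW re0)) powRAC.
  rewrite powR_inv1 ?powR_ge0// lef_pV2 ?posrE ?powR_gt0 ?divr_gt0//.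
    by move: qy; rewrite /y ler_pdivlMr// natrM mulrC.
  by rewrite ltr0n muln_gt0 e0.
- rewrite ltr0_norm; last by rewrite -oppr_gt0.
  rewrite -/l.
  have q2 : y <= 2 * q%:R.
    have : 1 <= q%:R :> R by rewrite ler1n.
    by move: yq; rewrite -natr1; lra.
  have : ln y <= ln 2 + ln (q%:R : R).
    by rewrite -lnM ?posrE// ler_ln ?posrE// mulr_gt0.
  rewrite lny => lnq.
  apply: (@le_trans _ _ (kappa * (p * l - C))).
    move: M2l; rewrite /M2 ler_pdivrMr ?subr_gt0//.
    lra.
  by rewrite ler_wpM2l// /C; lra.
Unshelve. all: by end_near. Qed.

Theorem theorem1p1 (R : realType) (d : nat) (p : R) (hd : (2 <= d)%N)
    (hp : 1 <= p) :
  ((p * (d%:R - 1))%:E <=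
     metric_mean_dim (@circle_pushforward R d) (@wasserstein R p))%E.
Proof.
case: d hd => [//|e]; rewrite ltnS => e0.
rewrite -natr1 addrK.
have p0 : 0 < p by exact: lt_le_trans hp.
apply/lee_subgt0Pr => t t0; rewrite -EFinB; set x := _ - t.
have [K Kt] : exists K : nat, x < K%:R / K.+1%:R * e%:R * p.
  (* The forced zeros cost p e / (K+1), which has to be less than t. *)
  exists (Num.truncn (p * e%:R / t)); set K := Num.truncn _.
  have K1 : p * e%:R < K.+1%:R * t.
    have pet0 : 0 <= p * e%:R / t.
      exact: divr_ge0 (mulr_ge0 (ltW p0) (ler0n _ e)) (ltW t0).
    have /andP[_] := truncn_itv pet0.
    by rewrite ltr_pdivrMr.
  rewrite -subr_gt0 (_ : _ - _ = (K.+1%:R * t - p * e%:R) / K.+1%:R).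
    by rewrite divr_gt0// subr_gt0.
  by rewrite /x -natr1; field; rewrite natr1 pnatr_eq0.
pose r : R := (e.+1%:R ^+ K)^-1 / (2 * e.+1%:R).
have r0 : 0 < r by rewrite divr_gt0 ?invr_gt0 ?exprn_gt0// mulr_gt0.
have k0 : 0 <= K%:R / K.+1%:R * e%:R :> R by rewrite mulr_ge0// divr_ge0.
apply: limf_einf_ge.
near=> eps.
have eps0 : 0 < eps by near: eps; exact: nbhs_right_gt.
have eps1 : eps < 1 by near: eps; exact: nbhs_right_lt.
(* The factor K e / (K+1) is the number of free grid coordinates per unit of time. *)
have [q [q0 epsle xq]] : exists q : nat,
    [/\ (0 < q)%N, eps <= r * ((e * q)%:R^-1) `^ p^-1 &
        x * `|ln eps| <= K%:R / K.+1%:R * e%:R * ln q%:R].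
  by near: eps; exact: grid_size.
have l0 : 0 < `|ln eps| by rewrite normr_gt0 lt_eqF// ln_lt0// eps0.
(* Using N + 1 blocks keeps the time positive, so that dividing by it is legitimate. *)
apply: limn_esup_ge => N; exists (N.+1 * K.+1)%N.
  by rewrite (leq_trans (leqnSn N))// leq_pmulr.
have nl0 : 0 < (N.+1 * K.+1)%:R * `|ln eps| by rewrite mulr_gt0// ltr0n.
rewrite inver gt_eqF// lee_pdivlMr//.
have card_gt0 : (0 < (q ^ e) ^ (N.+1 * K))%N by rewrite !expn_gt0 q0.
apply: (@le_trans _ _ (lne ((q ^ e) ^ (N.+1 * K))%:R%:E)); last first.
  have := sep_card_pushforward _ _ _ _ _ _ _ hp e0 q0 epsle.
  move=> /(_ N.+1) card_le.
  have in0y (z : \bar R) : (0 <= z)%E -> z \in `[0%E, +oo%E]%R.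
    by move=> z0; rewrite in_itv/= z0 leey.
  have ge0 : (0 <= ((q ^ e) ^ (N.+1 * K))%:R%:E :> \bar R)%E.
    by rewrite lee_fin ler0n.
  by rewrite lee_lne// in0y//; exact: le_trans card_le.
rewrite lne_EFin ?ltr0n// -EFinM lee_fin natrX lnXn ?ltr0n ?expn_gt0 ?q0//.
rewrite natrX lnXn ?ltr0n// mulrCA.
apply: (@le_trans _ _ ((N.+1 * K.+1)%:R * (K%:R / K.+1%:R * e%:R * ln q%:R))).
  by rewrite ler_wpM2l.
rewrite le_eqVlt; apply/orP; left; apply/eqP.
rewrite -[RHS]mulr_natr -[ln _ *+ e]mulr_natr !natrM; field.
by rewrite nat1r pnatr_eq0.
Unshelve. all: by end_near. Qed.
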